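(* Let $q$ be an odd prime power and let $f(x)=-x+x^{(q^2+1)/2}+x^{(q^3+q)/2}$. If $f(x)$ is a complete permutation polynomial over $\mathbb{F}_{q^3}$, then the compositional inverse of $f(x)+x$ over $\mathbb{F}_{q^3}$ is $$\left(f(x)+x\right)^{-1}=\left(\frac{x-x^q+x^{q^2}}{2}\right)^{q^3-q^2+q},$$ and the compositional inverse of $f(x)$ over $\mathbb{F}_{q^3}$ is $$f^{-1}(x)=\left(x^{q^2+q+1}\left(x^{q+1}-x^{2q}+x^{q^2+q}\right)^{q^3-2}\right)^{q^3-q^2+q}.$$
   Context: $\mathbb{F}_{q^3}$ is the finite field with $q^3$ elements. A polynomial $f\in\mathbb{F}_{q^3}[x]$ is a permutation polynomial of $\mathbb{F}_{q^3}$ if $c\mapsto f(c)$ is a bijection of $\mathbb{F}_{q^3}$; it is a complete permutation polynomial (CPP) if both $f(x)$ and $f(x)+x$ are permutation polynomials of $\mathbb{F}_{q^3}$. The compositional inverse of a permutation polynomial $g$ over $\mathbb{F}_{q^3}$, denoted $g^{-1}(x)$ (or $(g(x))^{-1}$), is the polynomial, unique modulo $x^{q^3}-x$, with $g(g^{-1}(x))\equiv g^{-1}(g(x))\equiv x\pmod{x^{q^3}-x}$; equalities are thus equalities of functions on $\mathbb{F}_{q^3}$. *)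

(* Defs.v *)
From HB Require Import structures.
From mathcomp Require Import all_boot all_order all_algebra all_field.

Set Implicit Arguments.
Unset Strict Implicit.
Unset Printing Implicit Defensive.

Import GRing.Theory.
Local Open Scope ring_scope.

Definition prime_power (q : nat) : Prop :=
  exists p k : nat, [/\ prime p, (0 < k)%N & q = (p ^ k)%N].

Definition permutation_poly (F : finFieldType) (g : {poly F}) : Prop :=
  bijective (fun c : F => g.[c]).

Definition complete_permutation_poly (F : finFieldType) (g : {poly F}) : Prop :=
  permutation_poly g /\ permutation_poly (g + 'X).

(* h represents the compositional inverse of g, which is only determined modulo
   X^#|F| - X; h need not be the representative of degree less than #|F|. *)
Definition is_compositional_inverse (F : finFieldType) (g h : {poly F}) : Prop :=
  (g \Po h) %% ('X^#|F| - 'X) = 'X %% ('X^#|F| - 'X) /\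
  (h \Po g) %% ('X^#|F| - 'X) = 'X %% ('X^#|F| - 'X).

(* The exponents are natural numbers: when q is odd both divisions by 2 are
   exact. *)
Definition cpp_candidate (F : finFieldType) (q : nat) : {poly F} :=
  - 'X + 'X^((q ^ 2 + 1) %/ 2)%N + 'X^((q ^ 3 + q) %/ 2)%N.

(* Main.v *)
Require Import Defs.
From mathcomp Require Import all_boot all_order all_algebra all_field.
From mathcomp Require Import zify ring.

Import GRing.Theory.
Local Open Scope ring_scope.

(** Put N = q ^ 3 and, for x in the field, let a = x ^ ((q ^ 2 + 1) / 2),
    b = a ^ q and c = a ^ (q ^ 2), so that c ^ q = a.  Everything reduces to
    three facts.

    - The element x is recovered from a: (q ^ 2 + 1) (q ^ 3 - q ^ 2 + q) / 2 is
      congruent to 1 modulo N - 1, whence a ^ (q ^ 3 - q ^ 2 + q) = x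
      ([expf_half_expK]).  Both claimed inverses are an expression meant to
      yield a, raised to this power.
    - Since (q ^ 3 + q) / 2 = q (q ^ 2 + 1) / 2, the value f(x) + x is a + b.
      The Frobenius conjugates of y = a + b are b + c and c + a, so that
      y - y ^ q + y ^ (q ^ 2) = 2 a.
    - The first fact reads x c = a b, hence y = f(x) is a + b - a b / c.
      Then y / a + y ^ q / c = 2, and with its conjugates this is a linear
      system in 1 / a, 1 / b, 1 / c; solving it for 1 / a gives
      a (y - y ^ q + y ^ (q ^ 2)) = y y ^ (q ^ 2)  ([conjugate_relation]).  For x != 0 one has y != 0 because f is
      injective and f(0) = 0; this keeps all the denominators nonzero, and
      the power N - 2 is inversion.

    Each of these computations gives a one-sided inverse as functions on the
    field; finiteness makes it two-sided, and polynomials that agree as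
    functions are congruent modulo X ^ N - X
    ([left_inverse_compositional], [modp_genPoly_ext]). *)

Section PolynomialFunctions.

Variable F : finFieldType.

Lemma modp_genPoly_ext (g h : {poly F}) :
    (forall c, g.[c] = h.[c]) ->
  g %% ('X^#|F| - 'X) = h %% ('X^#|F| - 'X).
Proof.
move=> eq_gh; apply/eqP; rewrite -subr_eq0 -modpN -modpD.
rewrite -/(_ %| _) finField_genPoly -big_enum /=.
apply: uniq_roots_dvdp; last by rewrite uniq_rootsE enum_uniq.
by apply/allP=> c _; rewrite rootE hornerD hornerN eq_gh subrr.
Qed.

Lemma left_inverse_compositional (g h : {poly F}) :
  cancel (horner g) (horner h) -> is_compositional_inverse g h.
Proof.
move=> gK; have hK : cancel (horner h) (horner g).
  by apply: canF_sym gK.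
by split; apply: modp_genPoly_ext => c; rewrite horner_comp hornerX.
Qed.

(** Exponents matter only modulo #|F| - 1; starting from exponent 1 instead of
    0 makes this hold at 0 as well. *)
Lemma expf_card_period (x : F) t : x ^+ (1 + t * #|F|.-1) = x.
Proof.
have cF : #|F|.-1.+1 = #|F| by rewrite prednK // (cardD1 0).
elim: t => [|t IHt]; first by rewrite mul0n addn0 expr1.
by rewrite mulSnr addnA exprD IHt -exprS cF expf_card.
Qed.

Lemma expf_card_sub2 (z : F) : (2 < #|F|)%N -> z ^+ (#|F| - 2) = z^-1.
Proof.
move=> N2; have [->|z0] := eqVneq z 0.
  by rewrite invr0 expr0n subn_eq0 leqNgt N2.
apply: (mulIf z0); apply: (mulIf z0).
by rewrite mulVf // mul1r -mulrA -expr2 -exprD subnK ?expf_card // ltnW.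
Qed.

(** The three sums A, B, C on the left are the images of a + b - a b / c under
    the cyclic shift a -> b -> c -> a; they satisfy A / a + B / c = B / b + C / a =
    A / b + C / c = 2, and eliminating 1 / b and 1 / c determines 1 / a. *)
Lemma conjugate_relation (x y z a b c : F) :
    a != 0 -> b != 0 -> c != 0 ->
    x * c = a * b -> y * a = b * c -> z * b = c * a ->
  a * ((- x + a + b) - (- y + b + c) + (- z + c + a)) =
  (- x + a + b) * (- z + c + a).
Proof.
move=> a0 b0 c0 /(canRL (mulfK c0)) -> /(canRL (mulfK a0)) ->.
move=> /(canRL (mulfK b0)) ->.
by field; rewrite a0 b0 c0.
Qed.

End PolynomialFunctions.

Section CubicExtension.

Variables (q : nat) (F : finFieldType).
Hypotheses (q_pp : prime_power q) (q_odd : odd q) (cardF : #|F| = (q ^ 3)%N).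

Local Notation half_exp := ((q ^ 2 + 1) %/ 2)%N.

Lemma card_pchar_nat : [pchar F].-nat q.
Proof.
have [p [k [p_pr _ q_eq]]] := q_pp.
have pF : p \in [pchar F].
  by apply: (@card_finPcharP _ p (k * 3)) => //; rewrite expnM -q_eq.
rewrite q_eq pnatX; apply/orP; left.
by rewrite pnatE.
Qed.

Lemma two_neq0 : 2%:R != 0 :> F.
Proof.
apply/negP=> two0; have F2 : 2%N \in [pchar F] by rewrite inE.
have q2nat : 2%N.-nat q by rewrite -(eq_pnat _ (pcharf_eq F2)) card_pchar_nat.
have q1 : q = 1%N by apply: (pnat_1 q2nat); rewrite -odd_2'nat.
by move: (finNzRing_gt1 F); rewrite cardF q1.
Qed.

Lemma Frobenius_q_add (x y : F) : (x + y) ^+ q = x ^+ q + y ^+ q.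
Proof. exact/exprDn_pchar/card_pchar_nat. Qed.

Lemma Frobenius_q_opp (x : F) : (- x) ^+ q = - x ^+ q.
Proof. exact/exprNn_pchar/card_pchar_nat. Qed.

Lemma Frobenius_q3 (x : F) : ((x ^+ q) ^+ q) ^+ q = x.
Proof. by rewrite -!exprM -[RHS]expf_card cardF !expnS expn0 muln1 mulnA. Qed.

(** With q = 2 m + 1 the product of the two exponents is
    1 + (1 + q m) (q ^ 3 - 1). *)
Lemma expf_half_expK (x : F) : (x ^+ half_exp) ^+ (q ^ 3 - q ^ 2 + q) = x.
Proof.
rewrite -exprM -[RHS](expf_card_period _ _ (1 + q * q./2)) cardF.
congr (_ ^+ _).
(* The ring identity needs exponents without subtraction or division. *)
have [m ->] : exists m, q = (2 * m + 1)%N.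
  by exists q./2; rewrite -{1}(odd_double_half q) q_odd -muln2 mulnC addnC.
have -> : ((2 * m + 1)./2 = m)%N by lia.
have -> : (((2 * m + 1) ^ 2 + 1) %/ 2 = 2 * m * m + 2 * m + 1)%N.
  by rewrite (_ : _ + 1 = (2 * m * m + 2 * m + 1) * 2)%N ?mulnK //; ring.
have -> : ((2 * m + 1) ^ 3 = (2 * m + 1) ^ 2 * (2 * m) + (2 * m + 1) ^ 2)%N.
  by ring.
rewrite addnK.
have -> : (((2 * m + 1) ^ 2 * (2 * m) + (2 * m + 1) ^ 2).-1 =
  (2 * m + 1) ^ 2 * (2 * m) + 4 * m * m + 4 * m)%N.
  by rewrite (_ : (2 * m + 1) ^ 2 * (2 * m) + (2 * m + 1) ^ 2 =
    ((2 * m + 1) ^ 2 * (2 * m) + 4 * m * m + 4 * m).+1)%N //; ring.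
ring.
Qed.

Lemma exp_half_conj (x : F) :
  x ^+ ((q ^ 3 + q) %/ 2)%N = (x ^+ half_exp) ^+ q.
Proof.
have q2_even : (2 %| q ^ 2 + 1)%N by rewrite dvdn2 oddD oddX q_odd.
by rewrite -exprM divn_mulAC // mulnDl mul1n -expnSr.
Qed.

(** This is x = a ^ (1 + q - q ^ 2) with the denominator cleared, so that it
    also holds at x = 0. *)
Lemma mul_half_conj2 (x : F) :
  x * ((x ^+ half_exp) ^+ q) ^+ q = x ^+ half_exp * (x ^+ half_exp) ^+ q.
Proof.
rewrite -{1}(expf_half_expK x); set a := x ^+ half_exp.
have q2_le : (q ^ 2 <= q ^ 3)%N by rewrite leq_pexp2l // odd_gt0.
rewrite -exprM mulnn -exprD addnAC subnK // exprD; congr (_ * _).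
by rewrite -cardF expf_card.
Qed.

Lemma horner_cpp_candidate (x : F) :
  (cpp_candidate F q).[x] = - x + x ^+ half_exp + (x ^+ half_exp) ^+ q.
Proof. by rewrite /cpp_candidate !hornerE exp_half_conj. Qed.

Lemma half_conj_trace (a : F) (y := a + a ^+ q) :
  2%:R^-1 * (y - y ^+ q + (y ^+ q) ^+ q) = a.
Proof.
rewrite /y !Frobenius_q_add Frobenius_q3.
by field; exact: two_neq0.
Qed.

(** The relation a (y - y ^ q + y ^ (q ^ 2)) = y y ^ (q ^ 2) solves for a once
    y - y ^ q + y ^ (q ^ 2) is known to be nonzero, and it proves this itself,
    its right-hand side being nonzero.  The common factor y ^ q of the quotient
    then cancels. *)
Lemma half_exp_of_candidate (x : F) (y := (cpp_candidate F q).[x]) :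
    x != 0 -> y != 0 ->
  y * y ^+ q * (y ^+ q) ^+ q *
    (y ^+ q * (y - y ^+ q + (y ^+ q) ^+ q))^-1 = x ^+ half_exp.
Proof.
move=> x0 y0.
have a0 : x ^+ half_exp != 0 by rewrite expf_neq0.
have xc := mul_half_conj2 x.
have ya : x ^+ q * x ^+ half_exp =
    (x ^+ half_exp) ^+ q * ((x ^+ half_exp) ^+ q) ^+ q.
  by rewrite -exprMn -xc exprMn Frobenius_q3.
have zb : (x ^+ q) ^+ q * (x ^+ half_exp) ^+ q =
    ((x ^+ half_exp) ^+ q) ^+ q * x ^+ half_exp.
  by rewrite -exprMn ya exprMn Frobenius_q3.
have yE : y = - x + x ^+ half_exp + (x ^+ half_exp) ^+ q.
  exact: horner_cpp_candidate.
have yqE : y ^+ q =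
    - x ^+ q + (x ^+ half_exp) ^+ q + ((x ^+ half_exp) ^+ q) ^+ q.
  by rewrite yE !Frobenius_q_add Frobenius_q_opp.
have yqqE : (y ^+ q) ^+ q =
    - (x ^+ q) ^+ q + ((x ^+ half_exp) ^+ q) ^+ q + x ^+ half_exp.
  by rewrite yqE !Frobenius_q_add Frobenius_q_opp Frobenius_q3.
have := conjugate_relation _ _ _ _ _ _ _
  a0 (expf_neq0 _ a0) (expf_neq0 _ (expf_neq0 _ a0)) xc ya zb.
rewrite -yE -yqE -yqqE => rel.
have B0 : y ^+ q != 0 by rewrite expf_neq0.
have D0 : y - y ^+ q + (y ^+ q) ^+ q != 0.
  have : y * (y ^+ q) ^+ q != 0 by rewrite mulf_neq0 // expf_neq0.
  by rewrite -rel mulf_eq0 negb_or => /andP[].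
by rewrite [y * _ * _]mulrAC -rel invfM mulrA !mulfK.
Qed.

End CubicExtension.

Theorem theorem4 (q : nat) (F : finFieldType) :
  prime_power q -> odd q -> #|F| = (q ^ 3)%N ->
  let f : {poly F} := cpp_candidate F q in
  complete_permutation_poly f ->
  is_compositional_inverse (f + 'X)
    ((2%:R^-1 *: ('X - 'X^q + 'X^(q ^ 2)%N)) ^+ (q ^ 3 - q ^ 2 + q)%N) /\
  is_compositional_inverse f
    (('X^(q ^ 2 + q + 1)%N *
      ('X^(q + 1)%N - 'X^(2 * q)%N + 'X^(q ^ 2 + q)%N) ^+ (q ^ 3 - 2)%N)
     ^+ (q ^ 3 - q ^ 2 + q)%N).
Proof.
move=> q_pp q_odd cardF f [/bij_inj f_inj _].
have q_gt0 : (0 < q)%N := odd_gt0 q_odd.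
have expq2 (y : F) : y ^+ (q ^ 2) = (y ^+ q) ^+ q by rewrite -exprM mulnn.
have fE (x : F) : f.[x] = - x + x ^+ ((q ^ 2 + 1) %/ 2)%N +
    (x ^+ ((q ^ 2 + 1) %/ 2)%N) ^+ q by exact: horner_cpp_candidate.
have fK := half_exp_of_candidate q F q_pp q_odd cardF.
rewrite -/f in fK.
(* Forgetting the value of f keeps f.[x] as an atom under evaluation rules. *)
clearbody f.
split; apply: left_inverse_compositional => x.
  have gE : f.[x] + x = x ^+ ((q ^ 2 + 1) %/ 2)%N +
      (x ^+ ((q ^ 2 + 1) %/ 2)%N) ^+ q by rewrite fE; ring.
  rewrite !hornerE gE expq2.
  by rewrite half_conj_trace // expf_half_expK.
rewrite !hornerE.
have e0 : (q ^ 3 - q ^ 2 + q)%N != 0%N by lia.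
have f0 : f.[0] = 0.
  rewrite fE oppr0 add0r.
  have h0 : ((q ^ 2 + 1) %/ 2)%N != 0%N by nia.
  by rewrite expr0n (negPf h0) add0r expr0n -[q == 0%N]negbK -lt0n q_gt0.
have [->|x0] := eqVneq x 0.
  by rewrite f0 addn1 exprS mul0r mul0r expr0n (negPf e0).
have y0 : f.[x] != 0 by rewrite -f0 (inj_eq f_inj).
rewrite -[RHS](@expf_half_expK q F) //; congr (_ ^+ _).
rewrite -fK //.
have N2 : (2 < #|F|)%N.
  have N_odd : odd (q ^ 3) by rewrite oddX.
  have N1 := finNzRing_gt1 F; rewrite cardF in N1 *.
  by case: (q ^ 3)%N N1 N_odd => [|[|[|n]]].
rewrite -cardF expf_card_sub2 //; congr (_ * _^-1).
  by rewrite !exprD expr1 expq2 mulrC [_ ^+ q * _]mulrC mulrA.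
rewrite exprD expr1 mulnC exprM expr2 exprD expq2; ring.
Qed.
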